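(* Let $R=\mathbb{Z}[U,V,W,X,Y,Z]/(UX+VY+WZ)$, let $x,y,z$ denote the images of $X,Y,Z$ in $R$, and let $\mathfrak{a}=(x,y,z)R$. Then for every prime integer $p$ the local cohomology module $H^3_{\mathfrak{a}}(R)$ contains a nonzero $p$-torsion element, i.e., an element $\eta\neq 0$ with $p\cdot\eta=0$. Consequently, $H^3_{\mathfrak{a}}(R)$ has infinitely many associated prime ideals.
   Context: $\mathbb{Z}[U,V,W,X,Y,Z]$ is the polynomial ring over the integers in six indeterminates. $H^3_{\mathfrak{a}}(R)$ is the third local cohomology module of $R$ with support in $\mathfrak{a}$; it can be identified with $\varinjlim_k R/(x^k,y^k,z^k)R$, where the maps in the direct system are induced by multiplication by $xyz$. *)

(* Defs.v *)
From HB Require Import structures.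
From mathcomp Require Import all_boot all_order all_algebra.
From mathcomp Require Import boolp classical_sets cardinality.
From mathcomp Require Import mpoly.

Set Implicit Arguments.
Unset Strict Implicit.
Unset Printing Implicit Defensive.

Import GRing.Theory.
Local Open Scope ring_scope.
Local Open Scope quotient_scope.

Definition ideal_gen (R : comNzRingType) (s : seq R) : {pred R} :=
  fun r => `[< exists c : 'I_(size s) -> R, r = \sum_i c i * s`_i >].

Section IdealGen.
Variables (R : comNzRingType) (s : seq R).

Lemma ideal_genP r :
  reflect (exists c : 'I_(size s) -> R, r = \sum_i c i * s`_i)
          (r \in ideal_gen s).
Proof. exact: asboolP. Qed.

Lemma ideal_gen_lin a : {in ideal_gen s &, forall u v, a * u + v \in ideal_gen s}.
Proof.
move=> _ _ /ideal_genP[c ->] /ideal_genP[d ->]; apply/ideal_genP.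
exists (fun i => a * c i + d i); rewrite mulr_sumr -big_split /=.
by apply: eq_bigr => i _; rewrite mulrDl mulrA.
Qed.

Lemma ideal_gen0 : 0 \in ideal_gen s.
Proof.
by apply/ideal_genP; exists (fun=> 0); rewrite big1 // => i _; rewrite mul0r.
Qed.

Lemma ideal_gen_mem g : g \in s -> g \in ideal_gen s.
Proof.
move=> gs; apply/ideal_genP; have gs' := gs; rewrite -index_mem in gs'.
exists (fun i => (i == Ordinal gs')%:R).
rewrite (bigD1 (Ordinal gs')) //= eqxx mul1r nth_index // big1 ?addr0 //.
by move=> i /negPf ->; rewrite mul0r.
Qed.

Lemma ideal_genM a u : u \in ideal_gen s -> a * u \in ideal_gen s.
Proof. by move=> us; rewrite -[_ * _]addr0 ideal_gen_lin // ideal_gen0. Qed.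

Lemma ideal_gen_sum (I : Type) (r : seq I) (P : pred I) (F : I -> R) :
  (forall i, P i -> F i \in ideal_gen s) ->
  \sum_(i <- r | P i) F i \in ideal_gen s.
Proof.
move=> h; elim/big_ind : _ => [|u v us vs|//]; first exact: ideal_gen0.
by rewrite -[u]mul1r ideal_gen_lin.
Qed.

End IdealGen.

(* [R] is viewed as a module over itself through [R^o], so that an ideal is
   a submodule. *)
Definition ideal_submod (R : comNzRingType) (s : seq R) : {pred R^o} :=
  ideal_gen s.

Section IdealSubmod.
Variables (R : comNzRingType) (s : seq R).

Lemma ideal_submod_closed : submod_closed (ideal_submod s).
Proof. by split; [exact: ideal_gen0 | move=> a u v; exact: ideal_gen_lin]. Qed.

HB.instance Definition _ :=
  GRing.isSubmodClosed.Build R R^o (ideal_submod s) ideal_submod_closed.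

End IdealSubmod.

Section SubmodZmod.
Variables (R : comNzRingType) (M : lmodType R) (N : submodClosed M).

(* [submodClosed] does not inherit from [zmodClosed], which the quotients of
   Z-modules require. *)
Definition submod_zmod : {pred M} := N.

Lemma submod_zmod_closed : zmod_closed submod_zmod.
Proof.
split=> [|u v uN vN]; first exact: (rpred0 N).
by rewrite -scaleN1r; apply: (rpredD (S := N)) => //; apply: (rpredZ (s := N)).
Qed.

HB.instance Definition _ :=
  GRing.isZmodClosed.Build M submod_zmod submod_zmod_closed.

End SubmodZmod.

Definition quotmod (R : comNzRingType) (M : lmodType R) (N : submodClosed M) :=
  Quotient.quot (submod_zmod N).

Section QuotMod.
Variables (R : comNzRingType) (M : lmodType R) (N : submodClosed M).
Local Notation Q := (quotmod N).

HB.instance Definition _ := GRing.Zmodule.on Q.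
HB.instance Definition _ := EqQuotient.on Q.

Definition qm_pi (u : M) : Q := \pi_(Quotient.quot (submod_zmod N)) u.

Lemma qm_piB : zmod_morphism qm_pi.
Proof. exact: (raddfB (\pi_(Quotient.quot (submod_zmod N)))). Qed.

HB.instance Definition _ := GRing.isZmodMorphism.Build M Q qm_pi qm_piB.

Lemma qm_pi_eq u v : (qm_pi u == qm_pi v) = (u - v \in N).
Proof. by rewrite (Quotient.idealrBE (submod_zmod N)). Qed.

Lemma qm_pi_eq0 u : (qm_pi u == 0) = (u \in N).
Proof. by rewrite -(raddf0 qm_pi) qm_pi_eq subr0. Qed.

Definition qm_repr (q : Q) : M := repr (q : Quotient.quot (submod_zmod N)).

Lemma qm_reprK : cancel qm_repr qm_pi.
Proof. exact: reprK. Qed.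

Definition qm_scale (a : R) (q : Q) : Q := qm_pi (a *: qm_repr q).

Lemma qm_scale_pi a u : qm_scale a (qm_pi u) = qm_pi (a *: u).
Proof.
by apply/eqP; rewrite qm_pi_eq -scalerBr rpredZ // -qm_pi_eq qm_reprK.
Qed.

Lemma qm_scaleA a b q : qm_scale a (qm_scale b q) = qm_scale (a * b) q.
Proof. by rewrite -[q]qm_reprK !qm_scale_pi scalerA. Qed.

Lemma qm_scale1 : left_id 1 qm_scale.
Proof. by move=> q; rewrite -[q]qm_reprK qm_scale_pi scale1r. Qed.

Lemma qm_scaleDr : right_distributive qm_scale +%R.
Proof.
move=> a q r; rewrite -[q]qm_reprK -[r]qm_reprK -raddfD !qm_scale_pi.
by rewrite scalerDr raddfD.
Qed.

Lemma qm_scaleDl q : {morph qm_scale^~ q : a b / a + b}.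
Proof.
by move=> a b; rewrite -[q]qm_reprK !qm_scale_pi scalerDl raddfD.
Qed.

HB.instance Definition _ :=
  GRing.Zmodule_isLmodule.Build R Q qm_scaleA qm_scale1 qm_scaleDr qm_scaleDl.

Lemma qm_piZ : scalable qm_pi.
Proof. by move=> a u; rewrite -[RHS]/(qm_scale a _) qm_scale_pi. Qed.

HB.instance Definition _ := GRing.isScalable.Build R M Q *:%R qm_pi qm_piZ.

End QuotMod.

Record dirsys (R : comNzRingType) := Dirsys {
  ds_obj :> nat -> lmodType R;
  ds_map : forall j k, (j <= k)%N -> {linear ds_obj j -> ds_obj k};
  ds_map_id : forall k (h : (k <= k)%N) u, ds_map h u = u;
  ds_map_comp : forall i j k (hij : (i <= j)%N) (hjk : (j <= k)%N)
    (hik : (i <= k)%N) u, ds_map hjk (ds_map hij u) = ds_map hik u }.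

Section DirLim.
Variables (R : comNzRingType) (M : dirsys R).

Local Notation T := {k : nat & M k}.
Local Notation mp := (@ds_map R M).

Definition dl_eq (u v : T) : bool :=
  `[< exists n (hu : (tag u <= n)%N) (hv : (tag v <= n)%N),
        mp hu (tagged u) = mp hv (tagged v) >].

Lemma dl_eqP u v :
  reflect (exists n (hu : (tag u <= n)%N) (hv : (tag v <= n)%N),
             mp hu (tagged u) = mp hv (tagged v)) (dl_eq u v).
Proof. exact: asboolP. Qed.

Lemma dl_eq_equiv : equiv_class_of dl_eq.
Proof.
split=> [u|u v|v u w].
- by apply/dl_eqP; exists (tag u), (leqnn _), (leqnn _).
- by apply/dl_eqP/dl_eqP => -[n [hu [hv e]]]; exists n, hv, hu.
- move=> /dl_eqP[m [hu [hv e]]] /dl_eqP[n [hv' [hw e']]]; apply/dl_eqP.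
  have hm := leq_maxl m n; have hn := leq_maxr m n.
  exists (maxn m n), (leq_trans hu hm), (leq_trans hw hn).
  rewrite -(ds_map_comp hu hm) e -(ds_map_comp hw hn) -e'.
  by rewrite !(ds_map_comp _ _ (leq_trans hv hm)).
Qed.

Canonical dl_equiv := EquivRelPack dl_eq_equiv.
Canonical dl_encModRel := defaultEncModRel dl_eq.

Definition dirlim := {eq_quot dl_eq}.

HB.instance Definition _ := Choice.on dirlim.
HB.instance Definition _ := EqQuotient.on dirlim.

Definition dl_inj k (u : M k) : dirlim := \pi_dirlim (Tagged (fun k => M k) u).

Lemma dl_inj_eq j k (u : M j) (v : M k) :
  dl_inj u = dl_inj v <->
  exists n (hj : (j <= n)%N) (hk : (k <= n)%N), mp hj u = mp hk v.
Proof.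
split=> [/eqP|h]; last by apply/eqP; rewrite piE; exact/dl_eqP.
by rewrite piE => /dl_eqP.
Qed.

Lemma dl_inj_map j k (h : (j <= k)%N) (u : M j) : dl_inj (mp h u) = dl_inj u.
Proof.
by apply/dl_inj_eq; exists k, (leqnn k), h; rewrite ds_map_id.
Qed.

Lemma dl_inj_surj (q : dirlim) : exists k (u : M k), q = dl_inj u.
Proof.
exists (tag (repr q)), (tagged (repr q)).
by rewrite /dl_inj -[LHS]reprK; case: (repr q).
Qed.

Definition dl_zero : dirlim := dl_inj (0 : M 0).

Definition dl_opp (q : dirlim) : dirlim := dl_inj (- tagged (repr q)).

Definition dl_add (p q : dirlim) : dirlim :=
  dl_inj (mp (leq_maxl (tag (repr p)) (tag (repr q))) (tagged (repr p)) +
          mp (leq_maxr (tag (repr p)) (tag (repr q))) (tagged (repr q))).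

Definition dl_scale (a : R) (q : dirlim) : dirlim :=
  dl_inj (a *: tagged (repr q)).

Lemma dl_repr_inj k (u : M k) : exists n (h : (tag (repr (dl_inj u)) <= n)%N)
  (hk : (k <= n)%N), mp h (tagged (repr (dl_inj u))) = mp hk u.
Proof.
apply/dl_inj_eq; rewrite -[RHS]reprK /dl_inj.
by case: (repr (\pi_dirlim _)).
Qed.

Lemma dl_opp_inj k (u : M k) : dl_opp (dl_inj u) = dl_inj (- u).
Proof.
have [n [h [hk e]]] := dl_repr_inj u.
by apply/dl_inj_eq; exists n, h, hk; rewrite raddfN [RHS]raddfN; congr (- _).
Qed.

Lemma dl_scale_inj a k (u : M k) : dl_scale a (dl_inj u) = dl_inj (a *: u).
Proof.
have [n [h [hk e]]] := dl_repr_inj u.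
by apply/dl_inj_eq; exists n, h, hk; rewrite linearZ [RHS]linearZ; congr (_ *: _).
Qed.

Lemma dl_add_map j k n (hj : (j <= n)%N) (hk : (k <= n)%N)
  (u : M j) (v : M k) : dl_add (dl_inj u) (dl_inj v) = dl_inj (mp hj u + mp hk v).
Proof.
have [m [hm [hjm e]]] := dl_repr_inj u.
have [m' [hm' [hkm e']]] := dl_repr_inj v.
pose l := maxn n (maxn m m').
have nl : (n <= l)%N by exact: leq_maxl.
have ml : (m <= l)%N by rewrite /l leq_max leq_maxl orbT.
have ml' : (m' <= l)%N by rewrite /l leq_max leq_maxr orbT.
have hl : (maxn (tag (repr (dl_inj u))) (tag (repr (dl_inj v))) <= l)%N.
  by rewrite geq_max (leq_trans hm ml) (leq_trans hm' ml').
apply/dl_inj_eq; exists l, hl, nl; rewrite !linearD /=.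
rewrite (ds_map_comp _ _ (leq_trans hm ml)) -(ds_map_comp hm ml) e.
rewrite (ds_map_comp _ _ (leq_trans hm' ml')) -(ds_map_comp hm' ml') e'.
rewrite (ds_map_comp _ _ (leq_trans hjm ml)).
rewrite (ds_map_comp _ _ (leq_trans hkm ml')).
by rewrite (ds_map_comp _ _ (leq_trans hjm ml)) (ds_map_comp _ _ (leq_trans hkm ml')).
Qed.

Lemma dl_add_inj k (u v : M k) : dl_add (dl_inj u) (dl_inj v) = dl_inj (u + v).
Proof. by rewrite (dl_add_map (leqnn k) (leqnn k)) !ds_map_id. Qed.

Lemma dl_common2 (p q : dirlim) :
  exists k (u v : M k), p = dl_inj u /\ q = dl_inj v.
Proof.
have [j [u ->]] := dl_inj_surj p; have [k [v ->]] := dl_inj_surj q.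
exists (maxn j k), (mp (leq_maxl j k) u), (mp (leq_maxr j k) v).
by rewrite !dl_inj_map.
Qed.

Lemma dl_common3 (p q r : dirlim) :
  exists k (u v w : M k), [/\ p = dl_inj u, q = dl_inj v & r = dl_inj w].
Proof.
have [j [u [v [-> ->]]]] := dl_common2 p q; have [k [w ->]] := dl_inj_surj r.
exists (maxn j k), (mp (leq_maxl j k) u), (mp (leq_maxl j k) v),
  (mp (leq_maxr j k) w).
by rewrite !dl_inj_map.
Qed.

Lemma dl_zero_inj k : dl_zero = dl_inj (0 : M k).
Proof. by rewrite -(raddf0 (mp (leq0n k))) dl_inj_map. Qed.

Lemma dl_addA : associative dl_add.
Proof.
move=> p q r; have [k [u [v [w [-> -> ->]]]]] := dl_common3 p q r.
by rewrite !dl_add_inj addrA.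
Qed.

Lemma dl_addC : commutative dl_add.
Proof.
move=> p q; have [k [u [v [-> ->]]]] := dl_common2 p q.
by rewrite !dl_add_inj addrC.
Qed.

Lemma dl_add0 : left_id dl_zero dl_add.
Proof.
move=> p; have [k [u ->]] := dl_inj_surj p.
by rewrite (dl_zero_inj k) dl_add_inj add0r.
Qed.

Lemma dl_addN : left_inverse dl_zero dl_opp dl_add.
Proof.
move=> p; have [k [u ->]] := dl_inj_surj p.
by rewrite dl_opp_inj dl_add_inj addNr -dl_zero_inj.
Qed.

HB.instance Definition _ :=
  GRing.isZmodule.Build dirlim dl_addA dl_addC dl_add0 dl_addN.

Lemma dl_addE k (u v : M k) : dl_inj u + dl_inj v = dl_inj (u + v).
Proof. exact: dl_add_inj. Qed.

Lemma dl_scaleA a b p : dl_scale a (dl_scale b p) = dl_scale (a * b) p.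
Proof.
by have [k [u ->]] := dl_inj_surj p; rewrite !dl_scale_inj scalerA.
Qed.

Lemma dl_scale1 : left_id 1 dl_scale.
Proof.
by move=> p; have [k [u ->]] := dl_inj_surj p; rewrite dl_scale_inj scale1r.
Qed.

Lemma dl_scaleDr : right_distributive dl_scale +%R.
Proof.
move=> a p q; have [k [u [v [-> ->]]]] := dl_common2 p q.
by rewrite dl_addE !dl_scale_inj dl_addE scalerDr.
Qed.

Lemma dl_scaleDl p : {morph dl_scale^~ p : a b / a + b}.
Proof.
move=> a b; have [k [u ->]] := dl_inj_surj p.
by rewrite !dl_scale_inj dl_addE scalerDl.
Qed.

HB.instance Definition _ := GRing.Zmodule_isLmodule.Build R dirlim
  dl_scaleA dl_scale1 dl_scaleDr dl_scaleDl.

Lemma dl_inj_linear k : linear (@dl_inj k).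
Proof.
move=> a u v; rewrite -[RHS]/(dl_add (dl_scale a _) _).
by rewrite dl_scale_inj dl_add_inj.
Qed.

HB.instance Definition _ k :=
  GRing.isLinear.Build R (M k) dirlim *:%R (@dl_inj k) (@dl_inj_linear k).

Lemma dl_inj_eq0 k (u : M k) :
  dl_inj u = 0 <-> exists n (h : (k <= n)%N), mp h u = 0.
Proof.
rewrite -[0]/dl_zero; split=> [|[n [h e]]].
  by case/dl_inj_eq => n [h [h0 e]]; exists n, h; rewrite e linear0.
rewrite -(dl_inj_map h u) (dl_zero_inj n).
exact: congr1 (@dl_inj n) _ _ e.
Qed.

End DirLim.

Arguments dl_inj {R} M {k} u.

(* For [s = [:: g_1; ...; g_n]], the direct system of the modules
   [R / (g_1 ^+ k, ..., g_n ^+ k)], with transition maps from index [j] to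
   index [k] induced by multiplication by [(g_1 * ... * g_n) ^+ (k - j)].
   Over a noetherian [R] its direct limit is the [n]-th local cohomology module
   of [R] with support in the ideal [(g_1, ..., g_n)].  For [n > 0] the index [k = 0]
   contributes a zero module and does not change the limit. *)
Section TopLocalCohomology.
Variables (R : comNzRingType) (s : seq R).

Definition pow_ideal (k : nat) : {pred R^o} :=
  ideal_submod [seq g ^+ k | g <- s].

HB.instance Definition _ k := GRing.SubmodClosed.on (pow_ideal k).

Definition pow_quot (k : nat) : lmodType R := quotmod (pow_ideal k).

Definition pow_quot_pi (k : nat) (r : R) : pow_quot k :=
  qm_pi (pow_ideal k) (r : R^o).

Definition pow_map j k (h : (j <= k)%N) (q : pow_quot j) : pow_quot k :=
  pow_quot_pi k ((\prod_(g <- s) g) ^+ (k - j) * qm_repr q).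

Lemma pow_ideal_shift j k r : (j <= k)%N -> r \in pow_ideal j ->
  (\prod_(g <- s) g) ^+ (k - j) * r \in pow_ideal k.
Proof.
move=> h /ideal_genP[c ->]; rewrite mulr_sumr; apply: ideal_gen_sum => i _.
have ilt : (i < size s)%N by rewrite -(size_map (fun g => g ^+ j) s).
rewrite (nth_map 0) // (big_rem s`_i) ?mem_nth //=.
set g := s`_i; set b := \prod_(_ <- _) _.
have -> : (g * b) ^+ (k - j) * (c i * g ^+ j) = b ^+ (k - j) * c i * g ^+ k.
  by rewrite exprMn [g ^+ _ * b ^+ _]mulrC mulrACA -exprD subnK.
apply: ideal_genM; apply: ideal_gen_mem; apply/mapP; exists g => //.
exact: mem_nth.
Qed.

Lemma pow_map_pi j k (h : (j <= k)%N) (r : R) :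
  pow_map h (pow_quot_pi j r) =
  pow_quot_pi k ((\prod_(g <- s) g) ^+ (k - j) * r).
Proof.
apply/eqP; rewrite /pow_map /pow_quot_pi qm_pi_eq -mulrBr.
by apply: pow_ideal_shift => //; rewrite -qm_pi_eq qm_reprK.
Qed.

Lemma pow_map_linear j k (h : (j <= k)%N) : linear (pow_map h).
Proof.
move=> a q r; rewrite -[q]qm_reprK -[r]qm_reprK -linearP.
rewrite -!/(pow_quot_pi _ _) !pow_map_pi /pow_quot_pi -linearP.
by congr (qm_pi _ _); rewrite mulrDr mulrCA.
Qed.

HB.instance Definition _ j k (h : (j <= k)%N) :=
  GRing.isLinear.Build R (pow_quot j) (pow_quot k) *:%R (pow_map h)
    (pow_map_linear h).

Lemma pow_map_id k (h : (k <= k)%N) q : pow_map h q = q.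
Proof.
rewrite -[q]qm_reprK -/(pow_quot_pi _ _) pow_map_pi subnn expr0 mul1r //.
Qed.

Lemma pow_map_comp i j k (hij : (i <= j)%N) (hjk : (j <= k)%N)
  (hik : (i <= k)%N) q : pow_map hjk (pow_map hij q) = pow_map hik q.
Proof.
rewrite -[q]qm_reprK -/(pow_quot_pi _ _) !pow_map_pi mulrA -exprD.
by rewrite addnBA // subnK.
Qed.

Definition pow_sys : dirsys R :=
  @Dirsys R pow_quot (fun j k h => pow_map h) pow_map_id pow_map_comp.

Definition top_local_cohomology : lmodType R := dirlim pow_sys.

End TopLocalCohomology.

Definition associated_prime (R : comNzRingType) (M : lmodType R)
    (P : pred R) : Prop :=
  [/\ idealr_closed P, prime_idealr_closed P &
      exists m : M, forall r, (r \in P) = (r *: m == 0)].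

Local Notation A6 := {mpoly int[6]}.

Definition vU : A6 := 'X_(@Ordinal 6 0 isT).
Definition vV : A6 := 'X_(@Ordinal 6 1 isT).
Definition vW : A6 := 'X_(@Ordinal 6 2 isT).
Definition vX : A6 := 'X_(@Ordinal 6 3 isT).
Definition vY : A6 := 'X_(@Ordinal 6 4 isT).
Definition vZ : A6 := 'X_(@Ordinal 6 5 isT).

Definition hyp_ideal : {pred A6} := ideal_gen [:: vU * vX + vV * vY + vW * vZ].

Lemma hyp_ideal_closed : idealr_closed hyp_ideal.
Proof.
split; [exact: ideal_gen0 | | exact: ideal_gen_lin].
apply/negP => /ideal_genP[c]; rewrite big_ord_recl big_ord0 addr0 /=.
move=> /(congr1 (meval (fun=> 0 : int))).
rewrite meval1 mevalM !mevalD !mevalM !mevalXU.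
by rewrite !(mulr0, addr0) => /eqP; rewrite oner_eq0.
Qed.

HB.instance Definition _ := isIdealr.Build A6 hyp_ideal hyp_ideal_closed.

Definition hypR : comNzRingType := {ideal_quot hyp_ideal}.

Definition hx : hypR := \pi_{ideal_quot hyp_ideal} vX.
Definition hy : hypR := \pi_{ideal_quot hyp_ideal} vY.
Definition hz : hypR := \pi_{ideal_quot hyp_ideal} vZ.

Definition H3a : lmodType hypR := top_local_cohomology [:: hx; hy; hz].

(* Main.v *)
From HB Require Import structures.
Require Import Defs.
From mathcomp Require Import all_boot all_order all_algebra.
From mathcomp Require Import boolp classical_sets cardinality.
From mathcomp Require Import mpoly.
From mathcomp Require Import zify.
From Stdlib Require Import Ring.

Set Implicit Arguments.
Unset Strict Implicit.
Unset Printing Implicit Defensive.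

Import GRing.Theory.

Local Open Scope ring_scope.
Local Open Scope classical_set_scope.
Local Open Scope quotient_scope.

(* Write A = ux, B = vy, C = wz, so A + B + C = 0, and let theta_p be the class
   of (AB)^(p-1) in R/(x^p, y^p, z^p), viewed in the direct limit. Expanding
   A^(p-2)(A + B)^p modulo A^p, B^p and C^p gives p theta_p = 0, and similar
   expansions, one step further in the direct system for u, v and w, show that
   all six variables kill theta_p. Hence R acts on theta_p through Z/p and, if
   theta_p <> 0, its annihilator is the maximal ideal (p, u, v, w, x, y, z);
   no noetherianity is needed to produce the associated primes.

   For theta_p <> 0, the relevant multidegree of the local cohomology is the
   degree 2p - 2 part of Z[A,B,C]/(A + B + C, A^p, B^p, C^p). The coefficient of
   (AB)^(p-1) modulo p, after C := -(A + B), is a functional on it which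
   kills C^p because C^p = -(A^p + B^p) modulo p. *)

(** * Ring identities and truncated binomial expansions *)

Section CommutativeRingTactic.
Variable R : comNzRingType.

Definition radd (a b : R) : R := a + b.
Definition rmul (a b : R) : R := a * b.
Definition ropp (a : R) : R := - a.
Definition rexp (a : R) n : R := a ^+ n.
Definition rnat n : R := n%:R.

Lemma comring_theory :
  @ring_theory R 0 1 radd rmul (fun a b => radd a (ropp b)) ropp eq.
Proof.
split=> //; [exact: add0r|exact: addrC|exact: addrA|exact: mul1r|exact: mulrC|
  exact: mulrA|exact: mulrDl|exact: subrr].
Qed.
End CommutativeRingTactic.

(* The same operation on [R] is reached by several paths in the hierarchy; [ring]
   only recognises it syntactically, hence after folding. *)
Ltac fold_ring R :=
  repeat match goal with
  | |- context [@GRing.add ?V ?a ?b] => change (@GRing.add V a b) with (@radd R a b)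
  | |- context [@GRing.mul ?V ?a ?b] => change (@GRing.mul V a b) with (@rmul R a b)
  | |- context [@GRing.opp ?V ?a] => change (@GRing.opp V a) with (@ropp R a)
  | |- context [@GRing.exp ?V ?a ?n] => change (@GRing.exp V a n) with (@rexp R a n)
  | |- context [@Algebra.natmul ?V (GRing.one ?W) ?n] =>
      change (@Algebra.natmul V (GRing.one W) n) with (@rnat R n)
  | |- context [@GRing.zero ?V] => progress change (@GRing.zero V) with (0 : R)
  | |- context [@GRing.one ?V] => progress change (@GRing.one V) with (1 : R)
  end;
  match goal with |- @eq _ ?a ?b => change (@eq (GRing.ComNzRing.sort R) a b) end.

Section CommutativeRingIdentities.
Variable R : comNzRingType.
Add Ring R_ring : (@comring_theory R).

(** With A = [a], B = 1 and C = -(1 + [a]), this is A + B + C = 0 times [t * b]. *)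
Lemma pascal_cancel (a t b : R) :
  a * t * b + t * b + t * (- (1 + a) * b) = 0.
Proof. by fold_ring R; ring. Qed.

Lemma mulr_split1D (e a t b : R) :
  t * (e * (1 + a) * b) = e * (t * b + t * a * b).
Proof. by fold_ring R; ring. Qed.

Lemma exprD_mod1 (a b : R) n :
  exists q, (a + b) ^+ n = b ^+ n + a * q.
Proof.
exists (\sum_(i < n) (a + b) ^+ (n.-1 - i) * b ^+ i).
by have := subrXX (a + b) b n; rewrite addrK => <-; rewrite [RHS]addrC subrK.
Qed.

Lemma exprD_mod2 (a b : R) n :
  exists q, (a + b) ^+ n.+1 = b ^+ n.+1 + n.+1%:R * a * b ^+ n + a ^+ 2 * q.
Proof.
elim: n => [|n [q IHn]].
  by exists 0; rewrite !expr1 expr0 mulr1n; fold_ring R; ring.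
exists (n.+1%:R * b ^+ n + (a + b) * q).
by rewrite exprS {}IHn ![_ ^+ _.+1]exprS expr0 [n.+2%:R]mulrSr; fold_ring R; ring.
Qed.

End CommutativeRingIdentities.

(** * Additive functionals on integer polynomials, given on monomials *)

Section MonomialFunctional.
Variables (n : nat) (V : zmodType) (F : 'X_{1..n} -> V).
Implicit Types q h : {mpoly int[n]}.

Definition mlin q : V := \sum_(m <- msupp q) F m *~ q@_m.

Lemma mlin_seq q s : uniq s -> {subset msupp q <= s} ->
  mlin q = \sum_(m <- s) F m *~ q@_m.
Proof.
move=> us sub; rewrite (bigID (mem (msupp q))) /= [X in _ + X]big1 ?addr0.
  rewrite -big_filter; apply: perm_big; apply: uniq_perm.
  - exact: msupp_uniq.
  - exact: filter_uniq.
  by move=> m; rewrite mem_filter; case: (boolP (m \in msupp q)) => // /sub ->.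
by move=> m; rewrite -mcoeff_eq0 => /eqP ->; rewrite mulr0z.
Qed.

Lemma mlinB : zmod_morphism mlin.
Proof.
move=> q h; pose s := undup (msupp q ++ msupp h).
have us : uniq s by exact: undup_uniq.
have sq : {subset msupp q <= s} by move=> m; rewrite mem_undup mem_cat => ->.
have sh : {subset msupp h <= s}.
  by move=> m; rewrite mem_undup mem_cat orbC => ->.
have sqh : {subset msupp (q - h) <= s} by move=> m /msuppB_le; rewrite mem_undup.
rewrite (mlin_seq us sq) (mlin_seq us sh) (mlin_seq us sqh).
by rewrite -sumrB; apply: eq_bigr => m _; rewrite mcoeffB mulrzBr.
Qed.

HB.instance Definition _ := GRing.isZmodMorphism.Build {mpoly int[n]} V mlin mlinB.

Lemma mlinX m : mlin 'X_[m] = F m.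
Proof. by rewrite /mlin msuppX big_seq1 mcoeffX eqxx. Qed.

(** Vanishing on a principal ideal is thus checked on monomial multiples only. *)
Lemma mlin_mull_eq0 h : (forall m, mlin ('X_[m] * h) = 0) ->
  forall q, mlin (q * h) = 0.
Proof.
move=> h0 q; rewrite [q]mpolyE mulr_suml raddf_sum big1 // => m _.
by rewrite -scalerAl -[q@_m]intz scaler_int raddfMz /= h0 mul0rz.
Qed.

End MonomialFunctional.

(** * Classes in the direct limit *)

Section TopLocalCohomologyClasses.
Variables (R : comNzRingType) (s : seq R).

Lemma top_class_eq0 k r :
  dl_inj (pow_sys s) (pow_quot_pi s k r : pow_sys s k) = 0 <->
  exists2 n, (k <= n)%N & (\prod_(g <- s) g) ^+ (n - k) * r \in pow_ideal s n.
Proof.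
split=> [/dl_inj_eq0[n [h e]]|[n h e]].
  exists n => //; have /eqP := etrans (esym (pow_map_pi s h r)) e.
  by rewrite qm_pi_eq0.
apply/dl_inj_eq0; exists n, h; rewrite [LHS]pow_map_pi.
by apply/eqP; rewrite qm_pi_eq0.
Qed.

Lemma top_classZ a k r :
  a *: (dl_inj (pow_sys s) (pow_quot_pi s k r : pow_sys s k)
        : top_local_cohomology s) =
  dl_inj (pow_sys s) (pow_quot_pi s k (a * r) : pow_sys s k).
Proof.
rewrite -[LHS]linearZ; congr (dl_inj _ _).
exact: esym (qm_piZ (pow_ideal s k) a (r : R^o)).
Qed.

End TopLocalCohomologyClasses.

Lemma pow_ideal3P (R : comNzRingType) (x y z : R) n r :
  r \in pow_ideal [:: x; y; z] n <->
  exists a b c, r = a * x ^+ n + b * y ^+ n + c * z ^+ n.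
Proof.
split=> [/ideal_genP[c ->]|[a [b [c ->]]]].
  by rewrite !big_ord_recl big_ord0 /= addr0 addrA; do 3!eexists.
apply/ideal_genP; exists (fun i => [:: a; b; c]`_i).
by rewrite !big_ord_recl big_ord0 /= addr0 addrA.
Qed.

(** * Prime torsion and annihilators *)

Lemma mulrn_coprime_eq0 (V : zmodType) (t : V) m n :
  coprime m n -> t *+ m = 0 -> t *+ n = 0 -> t = 0.
Proof.
case: m => [|m].
  by rewrite /coprime gcd0n => /eqP-> _; rewrite mulr1n.
move=> /eqP cmn tm tn; have [a _] := Bezoutl n (ltn0Sn m).
rewrite cmn => /dvdnP[b e].
have -> : t = t *+ (1 + a * n).
  by rewrite mulrnDr mulr1n mulnC mulrnA tn mul0rn addr0.
by rewrite e mulnC mulrnA tm mul0rn.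
Qed.

Lemma mulrn_eq0_prime (V : zmodType) (t : V) p n :
  prime p -> t != 0 -> t *+ p = 0 -> (t *+ n == 0) = (p %| n)%N.
Proof.
move=> pp t0 tp; apply/eqP/idP => [tn|/dvdnP[k ->]].
  apply: contraT; rewrite -prime_coprime // => cpn.
  by rewrite (mulrn_coprime_eq0 cpn tp tn) eqxx in t0.
by rewrite mulnC mulrnA tp mul0rn.
Qed.

Lemma mulrz_eq0_prime (V : zmodType) (t : V) p (c : int) :
  prime p -> t != 0 -> t *+ p = 0 -> (t *~ c == 0) = (p %| `|c|)%N.
Proof.
move=> pp t0 tp; rewrite -(mulrn_eq0_prime _ pp t0 tp).
by case: c => n //=; rewrite NegzE mulrNz oppr_eq0.
Qed.

(** An integer kills [t] exactly when [p] divides it, so primality of the annihilator is Euclid's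
    lemma. *)
Lemma associated_prime_ann (R : comNzRingType) (M : lmodType R) (t : M) p :
  prime p -> t != 0 -> t *+ p = 0 ->
  (forall r : R, exists c : int, r *: t = t *~ c) ->
  associated_prime M (fun r => r *: t == 0).
Proof.
move=> pp t0 tp act; split; last by exists t.
- split; rewrite ?inE.
  + by rewrite /in_mem /= scale0r.
  + by rewrite /in_mem /= scale1r.
  + move=> a u v; rewrite /in_mem /= => /eqP u0 /eqP v0.
    by rewrite scalerDl -scalerA u0 v0 scaler0 addr0.
move=> u v; rewrite /in_mem /= -scalerA.
have [[c uc] [d vd]] := (act u, act v).
rewrite vd -scalerMzr uc -mulrzA !(mulrz_eq0_prime _ pp t0 tp).
by rewrite abszM Euclid_dvdM.
Qed.

Definition hu : hypR := \pi_{ideal_quot hyp_ideal} vU.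
Definition hv : hypR := \pi_{ideal_quot hyp_ideal} vV.
Definition hw : hypR := \pi_{ideal_quot hyp_ideal} vW.

Local Notation iU := (@Ordinal 6 0 isT).
Local Notation iV := (@Ordinal 6 1 isT).
Local Notation iW := (@Ordinal 6 2 isT).
Local Notation iX := (@Ordinal 6 3 isT).
Local Notation iY := (@Ordinal 6 4 isT).
Local Notation iZ := (@Ordinal 6 5 isT).

(** * Nonvanishing: the coefficient functional modulo [p] *)

Section SocleFunctional.
Variable p : nat.
Hypothesis p_pr : prime p.

(* The coefficient of A^(p-1) B^(p-1) in A^a B^b (-(A + B))^c, where
   b = 2(p-1) - a - c, dehomogenized at B = 1. *)
Definition socle_coef (a c : nat) : 'F_p := ('X^a * (- (1 + 'X)) ^+ c)`_p.-1.

Lemma socle_coef_pascal a c :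
  socle_coef a.+1 c + socle_coef a c + socle_coef a c.+1 = 0.
Proof.
rewrite /socle_coef -!coefD !exprS.
set q := (X in polyseq X).
have -> : q = 0 by exact: pascal_cancel.
by rewrite coef0.
Qed.

Lemma socle_coef_ge a c : (p <= a)%N -> socle_coef a c = 0.
Proof.
by move=> pa; rewrite /socle_coef coefXnM; case: ltnP => //; have := prime_gt0 p_pr; lia.
Qed.

(** The polynomial has degree at most [a + c]. With b = 2(p-1) - a - c, this is the case b >= p,
    used for multiples of B^p. *)
Lemma socle_coef_small a c : (a + c < p.-1)%N -> socle_coef a c = 0.
Proof.
move=> ac; rewrite /socle_coef coefXnM; case: ltnP => // le_a.
apply: nth_default; apply: leq_trans (size_poly_exp_leq _ _) _.
by rewrite size_polyN addrC -polyC1 size_XaddC mul1n; lia.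
Qed.

(** Frobenius turns C^p into (-1)^p (1 + X^p): the summand from 1 has too low a degree, and X^p
    pushes the other past index p - 1. *)
Lemma socle_coef_frob a c : (p <= c)%N -> (a + c < p + p.-1)%N ->
  socle_coef a c = 0.
Proof.
move=> pc ac; have -> : c = (p + (c - p))%N by rewrite subnKC.
have pcharP : p \in [pchar {poly 'F_p}] by rewrite pchar_poly; exact: pchar_Fp.
have -> : socle_coef a (p + (c - p)) =
    (-1) ^+ p * (socle_coef a (c - p) + socle_coef (a + p) (c - p)).
  rewrite /socle_coef exprD (exprNn (1 + 'X)) exprDn_pchar ?pnatE //.
  rewrite -coefD -coefCM rmorphXn rmorphN1 expr1n exprD.
  by apply: (congr1 (fun q : {poly 'F_p} => q`_p.-1)); exact: mulr_split1D.
rewrite socle_coef_small ?socle_coef_ge ?leq_addl ?addr0 ?mulr0 //; lia.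
Qed.

(* The condition selects the monomials (XYZ)^k A^a B^b C^c with
   a + b + c = 2(p-1). *)
Definition socle_weight k (m : 'X_{1..6}) : 'F_p :=
  if [&& m iX == k + m iU, m iY == k + m iV, m iZ == k + m iW &
         m iU + m iV + m iW == p.-1.*2]%N
  then socle_coef (m iU) (m iW) else 0.

Definition socle_form k : {mpoly int[6]} -> 'F_p := mlin (socle_weight k).

HB.instance Definition _ k := GRing.isZmodMorphism.Build
  {mpoly int[6]} 'F_p (socle_form k) (mlinB (socle_weight k)).

Lemma socle_form_powX k g : socle_form k (g * vX ^+ (p + k)) = 0.
Proof.
apply: mlin_mull_eq0 => m; rewrite mpolyXn -mpolyXD mlinX /socle_weight.
rewrite !mnmDE !mulmnE !mnm1E /=.
by case: ifP => // h; rewrite socle_coef_ge //; lia.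
Qed.

Lemma socle_form_powY k g : socle_form k (g * vY ^+ (p + k)) = 0.
Proof.
have p0 := prime_gt0 p_pr.
apply: mlin_mull_eq0 => m; rewrite mpolyXn -mpolyXD mlinX /socle_weight.
rewrite !mnmDE !mulmnE !mnm1E /=.
by case: ifP => // h; rewrite socle_coef_small //; lia.
Qed.

Lemma socle_form_powZ k g : socle_form k (g * vZ ^+ (p + k)) = 0.
Proof.
have p0 := prime_gt0 p_pr.
apply: mlin_mull_eq0 => m; rewrite mpolyXn -mpolyXD mlinX /socle_weight.
rewrite !mnmDE !mulmnE !mnm1E /=.
by case: ifP => // h; rewrite socle_coef_frob //; lia.
Qed.

Lemma socle_form_hyp k g : socle_form k (g * (vU * vX + vV * vY + vW * vZ)) = 0.
Proof.
apply: mlin_mull_eq0 => m; rewrite -!mpolyXD !mulrDr -!mpolyXD !raddfD /= !mlinX.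
(* Normalizing successors makes the three selection conditions coincide, so one case split leaves
   the Pascal relation. *)
rewrite /socle_weight !mnmDE !mnm1E /= !addn0 !addn1 !addnS !addSn !eqSS.
by case: ifP => // _; rewrite ?addr0 ?socle_coef_pascal.
Qed.

Lemma socle_form_class k :
  socle_form k ((vX * vY * vZ) ^+ k * ((vU * vX) ^+ p.-1 * (vV * vY) ^+ p.-1)) = 1.
Proof.
rewrite /socle_form -!mpolyXD !mpolyXn -!mpolyXD mlinX /socle_weight.
rewrite !(mnmDE, mulmnE, mnm1E) /=.
rewrite ifT; last by lia.
by rewrite !(addn0, mul0n, mul1n) /socle_coef mulr1 coefXn eqxx.
Qed.

Lemma socle_form_separates k a b c d :
  (vX * vY * vZ) ^+ k * ((vU * vX) ^+ p.-1 * (vV * vY) ^+ p.-1) -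
    (a * vX ^+ (p + k) + b * vY ^+ (p + k) + c * vZ ^+ (p + k)) <>
  d * (vU * vX + vV * vY + vW * vZ).
Proof.
move=> /(congr1 (socle_form k)).
rewrite raddfB 2!(raddfD (socle_form k)) /= socle_form_class socle_form_hyp.
rewrite socle_form_powX socle_form_powY socle_form_powZ !addr0 subr0 => /eqP.
by rewrite oner_eq0.
Qed.

Lemma socle_class_notin n : (p <= n)%N ->
  (hx * hy * hz) ^+ (n - p) * ((hu * hx) ^+ p.-1 * (hv * hy) ^+ p.-1)
    \notin pow_ideal [:: hx; hy; hz] n.
Proof.
move=> /subnKC; move: (n - p)%N => k <-{n}; apply/negP => /pow_ideal3P[a [b [c]]].
(* Lifting to polynomials turns the equality in [hypR] into one up to a multiple of the defining
   relation. *)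
rewrite -[a]reprK -[b]reprK -[c]reprK.
set a' := repr a; set b' := repr b; set c' := repr c.
rewrite -!(rmorphM, rmorphXn, rmorphD) => /eqP.
rewrite -Quotient.idealrBE => /ideal_genP[d].
by rewrite big_ord_recl big_ord0 addr0 => /socle_form_separates.
Qed.

End SocleFunctional.

(** * Annihilation of the class by the variables and by [p] *)

Section SocleClass.
Variables (R : comNzRingType) (x y z u v w : R).
Hypothesis rel : u * x + v * y + w * z = 0.

Add Ring R_ring : (@comring_theory R).

Local Notation H := (top_local_cohomology [:: x; y; z]).

Definition socle_class p : H :=
  dl_inj (pow_sys [:: x; y; z])
    (pow_quot_pi [:: x; y; z] p ((u * x) ^+ p.-1 * (v * y) ^+ p.-1)
     : pow_sys [:: x; y; z] p).

Lemma socle_classZ_eq0 p r j a b c :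
  (x * y * z) ^+ j * (r * ((u * x) ^+ p.-1 * (v * y) ^+ p.-1)) =
    a * x ^+ (j + p) + b * y ^+ (j + p) + c * z ^+ (j + p) ->
  r *: socle_class p = 0.
Proof.
move=> e; rewrite top_classZ; apply/top_class_eq0; exists (j + p)%N.
  exact: leq_addl.
apply/pow_ideal3P; exists a, b, c.
by rewrite !big_cons big_nil mulr1 addnK mulrA.
Qed.

Let relD : u * x + v * y = - (w * z).
Proof. by apply/eqP; rewrite -addr_eq0 rel. Qed.

Lemma socle_class_x p : (0 < p)%N -> x *: socle_class p = 0.
Proof.
case: p => // q _.
apply: (@socle_classZ_eq0 _ _ 0 (u ^+ q * (v * y) ^+ q) 0 0).
by rewrite /= add0n !exprMn !exprS ?expr0; fold_ring R; ring.
Qed.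

Lemma socle_class_y p : (0 < p)%N -> y *: socle_class p = 0.
Proof.
case: p => // q _.
apply: (@socle_classZ_eq0 _ _ 0 0 (v ^+ q * (u * x) ^+ q) 0).
by rewrite /= add0n !exprMn !exprS ?expr0; fold_ring R; ring.
Qed.

Lemma socle_class_z p : (0 < p)%N -> z *: socle_class p = 0.
Proof.
case: p => // q _; have [t e] := exprD_mod1 (u * x) (v * y) q.
apply: (@socle_classZ_eq0 _ _ 0 (- z * u ^+ q.+1 * t) 0
          ((u * x) ^+ q * (- w) ^+ q)).
(* Modulo A, B^q is (-C)^q; the error term, times A^q, is a multiple of A^(q+1). *)
have -> : (v * y) ^+ q = (- (w * z)) ^+ q - u * x * t by rewrite -relD e addrK.
by rewrite /= add0n -[- (w * z)]mulNr !exprMn !exprS ?expr0; fold_ring R; ring.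
Qed.

(** One step further, the new factor [x] completes A^(p-1) to A^p, which is (-C)^p modulo B; the new
    [y] and [z] supply the last missing power. *)
Lemma socle_class_u p : (0 < p)%N -> u *: socle_class p = 0.
Proof.
case: p => // q _; have [t e] := exprD_mod1 (v * y) (u * x) q.+1.
apply: (@socle_classZ_eq0 _ _ 1 0 (- (v ^+ q.+1 * z * t))
          (y * (- w) ^+ q.+1 * (v * y) ^+ q)).
have {}e : (u * x) ^+ q.+1 = (- (w * z)) ^+ q.+1 - v * y * t.
  by rewrite -relD [u * x + _]addrC e addrK.
transitivity (y * z * (u * x) ^+ q.+1 * (v * y) ^+ q).
  by rewrite /= expr1 exprS; fold_ring R; ring.
by rewrite e add1n -[- (w * z)]mulNr !exprMn !exprS ?expr0; fold_ring R; ring.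
Qed.

Lemma socle_class_v p : (0 < p)%N -> v *: socle_class p = 0.
Proof.
case: p => // q _; have [t e] := exprD_mod1 (u * x) (v * y) q.+1.
apply: (@socle_classZ_eq0 _ _ 1 (- (u ^+ q.+1 * z * t)) 0
          (x * (- w) ^+ q.+1 * (u * x) ^+ q)).
have {}e : (v * y) ^+ q.+1 = (- (w * z)) ^+ q.+1 - u * x * t.
  by rewrite -relD e addrK.
transitivity (x * z * (v * y) ^+ q.+1 * (u * x) ^+ q).
  by rewrite /= expr1 exprS; fold_ring R; ring.
by rewrite e add1n -[- (w * z)]mulNr !exprMn !exprS ?expr0; fold_ring R; ring.
Qed.

(** The new factor [z] completes [w] to C = -(A + B); the new [x] and [y] raise the resulting A^p
    and B^p to the next powers of [x] and [y]. *)
Lemma socle_class_w p : (0 < p)%N -> w *: socle_class p = 0.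
Proof.
case: p => // q _.
apply: (@socle_classZ_eq0 _ _ 1 (- (y * u ^+ q.+1 * (v * y) ^+ q))
          (- (x * v ^+ q.+1 * (u * x) ^+ q)) 0).
transitivity (x * y * (w * z) * (u * x) ^+ q * (v * y) ^+ q).
  by rewrite /= expr1; fold_ring R; ring.
rewrite -[w * z]opprK -relD.
by rewrite add1n !exprMn !exprS ?expr0; fold_ring R; ring.
Qed.

Lemma socle_class_torsion p : (1 < p)%N -> socle_class p *+ p = 0.
Proof.
case: p => [|[|n]] // _; rewrite -scaler_nat.
(* Here p = n + 2: multiplying by A^n turns the linear term into p(AB)^(p-1) and the remainder into
   a multiple of A^p. *)
have [t e] := exprD_mod2 (u * x) (v * y) n.+1.
apply: (@socle_classZ_eq0 _ _ 0 (- (u ^+ n.+2 * t)) (- ((u * x) ^+ n * v ^+ n.+2))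
          ((u * x) ^+ n * (- w) ^+ n.+2)).
transitivity ((u * x) ^+ n * ((- (w * z)) ^+ n.+2
  - (v * y) ^+ n.+2 - (u * x) ^+ 2 * t)).
  by rewrite -relD e /= expr0 [(u * x) ^+ n.+1]exprS; fold_ring R; ring.
by rewrite add0n -[- (w * z)]mulNr !exprMn !exprS ?expr0; fold_ring R; ring.
Qed.

End SocleClass.

(** * The hypersurface ring and its associated primes *)

Lemma hyp_rel : hu * hx + hv * hy + hw * hz = 0.
Proof.
rewrite -!(rmorphM, rmorphD) -(rmorph0 (\pi_{ideal_quot hyp_ideal})).
apply/eqP; rewrite -Quotient.idealrBE subr0.
by apply: ideal_gen_mem; rewrite inE.
Qed.

Definition torsion_class (p : nat) : H3a := socle_class hx hy hz hu hv p.

Lemma torsion_class_neq0 p : prime p -> torsion_class p != 0.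
Proof.
move=> pp; apply/eqP => /top_class_eq0[n le_pn].
rewrite !big_cons big_nil mulr1 [hx * _]mulrA.
exact/negP/socle_class_notin.
Qed.

Lemma pi_var_torsion_class p (i : 'I_6) : prime p ->
  \pi_{ideal_quot hyp_ideal} 'X_i *: torsion_class p = 0.
Proof.
move=> /prime_gt0 p0.
(* [isT] is the bound proof inside [vU], ..., [vZ], so each case matches by conversion. *)
case: i => [[|[|[|[|[|[|m]]]]]] im] //; rewrite (bool_irrelevance im isT).
- exact: socle_class_u hyp_rel _ p0.
- exact: socle_class_v hyp_rel _ p0.
- exact: socle_class_w hyp_rel _ p0.
- exact: socle_class_x.
- exact: socle_class_y.
- exact: socle_class_z hyp_rel _ p0.
Qed.

(** Every nonconstant monomial contains a variable and so acts as zero; [c] is the constant term of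
    a representative. *)
Lemma hypR_act_torsion_class p (r : hypR) : prime p ->
  exists c : int, r *: torsion_class p = torsion_class p *~ c.
Proof.
move=> pp; rewrite -[r]reprK; elim/mpolyind: (repr r) => [|c m g _ _ [d IH]].
  by exists 0; rewrite rmorph0 scale0r.
rewrite rmorphD scalerDl {}IH -[c]intz scaler_int rmorphMz -scalerMzl.
have [->|m0] := eqVneq m 0%MM.
  by exists (c + d); rewrite mpolyX0 rmorph1 scale1r mulrzDr.
have [i mi] : exists i, m i != 0%N.
  apply/existsP; apply: contraR m0 => /existsPn m0.
  by apply/eqP/mnmP => i; rewrite mnm0E; apply/eqP; rewrite -[_ == _]negbK m0.
exists d; rewrite -(submK (m := U_(i)%MM) (m' := m)) ?lep1mP //.
by rewrite mpolyXD rmorphM -scalerA pi_var_torsion_class // scaler0 mul0rz add0r.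
Qed.

Lemma infinite_primes : infinite_set [set p | prime p].
Proof.
move=> /finite_seqP[s sE]; have [p lt_p pp] := prime_above (\max_(i <- s) i).
have ps : p \in s by have : [set p | prime p] p by []; rewrite sE.
have : (p <= \max_(i <- s) i)%N by apply: leq_bigmax_seq.
by rewrite leqNgt lt_p.
Qed.

Theorem mainTheorem2 :
  (forall p : nat, prime p -> exists eta : H3a, eta != 0 /\ eta *+ p = 0) /\
  infinite_set [set P : pred hypR | associated_prime H3a P].
Proof.
have tors p : prime p -> torsion_class p *+ p = 0.
  by move=> /prime_gt1; apply: socle_class_torsion hyp_rel _.
split=> [p pp|fin]; first by exists (torsion_class p); rewrite torsion_class_neq0 // tors.
(* Guarded by [prime p] so that [ann] is injective on the preimage of the
   associated primes. *)
pose ann p : pred hypR := fun r => prime p && (r *: torsion_class p == 0).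
have ann_prime p : associated_prime H3a (ann p) -> prime p.
  (* An ideal contains 0, whereas [ann p] is empty for [p] not prime. *)
  by case=> -[]; rewrite /in_mem /= /ann; case: (prime p).
have mem_ann p q : prime p -> (q%:R \in ann p) = (p %| q)%N.
  move=> pp; rewrite /in_mem /= /ann pp scaler_nat.
  by rewrite (mulrn_eq0_prime _ pp) ?tors ?torsion_class_neq0.
apply: infinite_primes; apply: sub_finite_set (finite_preimage (f := ann) _ fin).
  move=> p pp; rewrite /= /ann pp; apply: (@associated_prime_ann _ _ _ p) => //.
  - exact: torsion_class_neq0.
  - exact: tors.
  - by move=> r; apply: hypR_act_torsion_class.
move=> p q /set_mem/ann_prime pp /set_mem/ann_prime pq e.
(* Equal annihilators contain the same integers, and [q] lies in [ann q]; hence [p] divides [q]. *)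
have := mem_ann p q pp; rewrite e (mem_ann q q pq) dvdnn => /esym.
by clear e; rewrite (dvdn_prime2 pp pq) => /eqP.
Qed.
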